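(* For any real number $\alpha>0$, $$\Gamma(\alpha)\,\Gamma\left(\alpha+\frac{1}{2}\right) = 2^{1-2\alpha}\sqrt{\pi}\,\Gamma(2\alpha).$$
   Context: The Gamma function $\Gamma:(0,\infty)\to\mathbf{R}$ is defined by $\Gamma(\alpha)=\int_0^\infty e^{-t}t^{\alpha-1}\,dt$. *)

(* Defs.v *)
From HB Require Import structures.
From mathcomp Require Import all_boot all_order all_algebra.
From mathcomp Require Import all_classical all_reals all_analysis.

Set Implicit Arguments.
Unset Strict Implicit.
Unset Printing Implicit Defensive.

Import Order.TTheory GRing.Theory Num.Theory.
Import numFieldNormedType.Exports.

Local Open Scope classical_set_scope.
Local Open Scope ring_scope.

(* Total on R; meaningful only for 0 < a, where the Lebesgue integral is finite.
   The domain excludes 0, where powR returns the default 0 `^ x = 0 (x != 0). *)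
Definition Gamma (R : realType) (a : R) : R :=
  \int[lebesgue_measure]_(t in `]0, +oo[) (expR (- t) * t `^ (a - 1)).

(* Main.v *)
Require Import Defs.
From HB Require Import structures.
From mathcomp Require Import all_boot all_order all_algebra.
From mathcomp Require Import all_classical all_reals all_analysis.
From mathcomp Require Import measurable_realfun ring.

(** The product [Gamma a * Gamma (a + 1/2)] is a double integral over the
    positive quadrant.  The substitution [t = x ^ 2] in each factor
    ([Gamma_integral_gauss]) turns it into four times the integral of
    [f x * f y * y], where [f x = exp (- x^2) * x^(2a - 1)].

    Only the last factor [y] breaks the symmetry in [x] and [y].  Folding the
    quadrant along its diagonal ([integral_quadrant_fold]) restores it: the
    integrand becomes [f x * f y * (x + y)] on the octant [0 < x < y].  In the
    coordinates [v = 2xy] and [d = y - x] one has [x^2 + y^2 = v + d^2], and the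
    area element is [dv dd = 2 (x + y) dx dy]; the factor [x + y] created by the
    folding is thus half the Jacobian, and the integral splits into that of
    [exp (- v) * v^(2a - 1)], which is [Gamma (2a)], times the Gaussian integral
    of [exp (- d^2)], which is [sqrt pi / 2], times a power of [2].

    The planar change of variables is done one coordinate at a time: a
    translation [y = x + d] ([integral_shear]), an exchange of the order of
    integration ([tonelli_region]), and for fixed [d] the substitution
    [v = 2x (x + d)] ([Gamma_integral_quadratic]).  All integrands are
    nonnegative, so the identity is proved between integrals with values in
    [[0, +oo]] ([Gamma_integral_duplication]), where no integrability has to be
    checked; it passes to real values because the integrals are positive and
    [fine] is multiplicative on positive extended reals ([fineM_gt0]). *)

Import Order.TTheory GRing.Theory Num.Theory.
Import numFieldNormedType.Exports.

Local Open Scope classical_set_scope.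
Local Open Scope ring_scope.

(** * Substitution on open half-lines *)

Lemma measurable_fun_continuous_oy (R : realType) (f : R -> R) (a : R) :
  {in `]a, +oo[, continuous f} -> measurable_fun `]a, +oo[ (EFin \o f).
Proof.
move=> cf; apply/measurable_EFinP.
apply: open_continuous_measurable_fun; first exact: interval_open.
by move=> x; rewrite inE/=; exact: cf.
Qed.

(** The half-lines are open on purpose: [G] may blow up at [b], as a power of
    negative exponent does at [0], and [dF] may be unbounded.  On each compact
    interval [[l n, r n]] inside the half-line the classical theorem applies,
    and monotone convergence exhausts both sides. *)
Lemma ge0_integral_substitution_oy (R : realType) (F dF G : R -> R) (a b : R) :
  (forall x : R, is_derive x 1 F (dF x)) -> continuous dF ->
  {in `]a, +oo[ &, {homo F : x y / x < y}} ->
  F @` `]a, +oo[ = `]b, +oo[%classic ->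
  {in `]b, +oo[, continuous G} -> {in `]b, +oo[, forall y, 0 <= G y} ->
  (\int[lebesgue_measure]_(y in `]b, +oo[) (G y)%:E =
   \int[lebesgue_measure]_(x in `]a, +oo[) (G (F x) * dF x)%:E)%E.
Proof.
move=> derF cdF incrF imF cG G0.
have F'E : (F^`())%classic = dF.
  by apply/funext => x; rewrite derive1E derive_val.
have cF : continuous F.
  move=> x; apply/differentiable_continuous/derivable1_diffP.
  exact: (@ex_derive _ _ _ _ _ _ _ (derF _)).
have bF x : a < x -> b < F x.
  move=> ax; have : (F @` `]a, +oo[) (F x).
    by exists x => //=; rewrite in_itv/= ax.
  by rewrite imF/= in_itv/= andbT.
have dF0 x : a < x -> 0 <= dF x.
  move=> ax; rewrite -F'E; apply: (@incr_derive1_ge0 _ _ `]a, +oo[%classic).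
  - by move=> x0 _; exact: (@ex_derive _ _ _ _ _ _ _ (derF x0)).
  - by move=> x1 x2; rewrite !inE/=; exact: incrF.
  - rewrite (_ : _° = `]a, +oo[%classic); last exact/interior_id/interval_open.
    by rewrite /= in_itv/= ax.
pose l n : R := a + n.+1%:R^-1.
pose r n : R := a + n.+1%:R.
have al n : a < l n by rewrite ltrDl invr_gt0.
have lr n : l n <= r n.
  by rewrite lerD2l (@le_trans _ _ 1)// ?invf_le1// ler1n.
have ar n : a < r n by exact: lt_le_trans (al n) (lr n).
have F_le x y : a < x -> x <= y -> F x <= F y.
  move=> ax; rewrite le_eqVlt => /predU1P[->//|xy].
  by apply/ltW/incrF => //; rewrite in_itv/= ?ax// (lt_trans ax).
have l_nincr m n : (m <= n)%N -> l n <= l m.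
  by move=> mn; rewrite lerD2l lef_pV2 ?posrE// ler_nat.
have r_incr m n : (m <= n)%N -> r m <= r n by move=> mn; rewrite lerD2l ler_nat.
have exhaust x : a < x -> exists n, l n <= x <= r n.
  move=> ax.
  pose n1 := Num.truncn (x - a)^-1; pose n2 := Num.truncn (x - a).
  exists (maxn n1 n2); apply/andP; split.
    apply: (le_trans (l_nincr _ _ (leq_maxl n1 n2))).
    rewrite -lerBrDl -[leRHS]invrK lef_pV2 ?posrE// ?invr_gt0 ?subr_gt0//.
    by apply/ltW/truncnS_gt.
  apply: (le_trans _ (r_incr _ _ (leq_maxr n1 n2))).
  by rewrite -lerBlDl; apply/ltW/truncnS_gt.
have UD : \bigcup_n `[l n, r n]%classic = `]a, +oo[%classic.
  apply/seteqP; split=> [x [n _]|x] /=; rewrite !in_itv/= ?andbT.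
    by move=> /andP[+ _]; exact: lt_le_trans.
  by move=> /exhaust[n xn]; exists n => //=; rewrite in_itv.
have UE : \bigcup_n `[F (l n), F (r n)]%classic = `]b, +oo[%classic.
  apply/seteqP; split=> [y [n _]|y] /=; rewrite !in_itv/= ?andbT.
    by move=> /andP[+ _]; apply: lt_le_trans; exact: bF.
  move=> yb; have : (F @` `]a, +oo[) y by rewrite imF/= in_itv/= yb.
  move=> [x /=]; rewrite in_itv/= andbT => ax <-.
  have [n /andP[lx xr]] := exhaust _ ax.
  by exists n => //=; rewrite in_itv/= !F_le.
have mG := measurable_fun_continuous_oy _ _ _ cG.
have mGF : measurable_fun `]a, +oo[ (EFin \o (fun x => G (F x) * dF x)).
  apply: measurable_fun_continuous_oy => x; rewrite in_itv/= andbT => ax.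
  apply: continuousM; last exact: cdF.
  apply: continuous_comp; first exact: cF.
  by apply: cG; rewrite in_itv/= bF.
have subD n m : (n <= m)%N -> `[l n, r n]%classic `<=` `[l m, r m]%classic.
  by move=> nm; apply: subset_itv; rewrite bnd_simp ?l_nincr ?r_incr.
have subE n m : (n <= m)%N ->
    `[F (l n), F (r n)]%classic `<=` `[F (l m), F (r m)]%classic.
  by move=> nm; apply: subset_itv; rewrite bnd_simp F_le ?l_nincr ?r_incr.
have cvgL : (\int[lebesgue_measure]_(y in `[F (l n), F (r n)]) (G y)%:E
    @[n --> \oo] --> \int[lebesgue_measure]_(y in `]b, +oo[) (G y)%:E)%E.
  rewrite -UE; apply: ge0_nondecreasing_set_cvg_integral => //.
  - by move=> n m nm; exact/subsetPset/subE.
  - move=> n; apply: measurable_funS mG => //.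
    by rewrite -UE => y yn; exists n.
  - move=> n y yn; rewrite lee_fin G0//.
    have : (\bigcup_n `[F (l n), F (r n)]%classic) y by exists n.
    by rewrite UE.
have cvgR : (\int[lebesgue_measure]_(x in `[l n, r n]) (G (F x) * dF x)%:E
    @[n --> \oo] -->
    \int[lebesgue_measure]_(x in `]a, +oo[) (G (F x) * dF x)%:E)%E.
  rewrite -UD; apply: ge0_nondecreasing_set_cvg_integral => //.
  - by move=> n m nm; exact/subsetPset/subD.
  - move=> n; apply: measurable_funS mGF => //.
    by rewrite -UD => x xn; exists n.
  - move=> n x xn; have : (\bigcup_n `[l n, r n]%classic) x by exists n.
    rewrite UD/= in_itv/= andbT => ax.
    by rewrite lee_fin mulr_ge0 ?dF0 ?G0// in_itv/= bF.
rewrite -(cvg_lim _ cvgL)// -(cvg_lim _ cvgR)//.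
congr (limn _); apply/funext => n.
rewrite (@integration_by_substitution_increasing _ F) ?F'E//.
- move=> x y; rewrite !in_itv/= => /andP[lx _] /andP[ly _].
  by apply: incrF; rewrite in_itv/= (lt_le_trans (al n)).
- by apply/cvg_ex; exists (dF (l n)); apply: cvg_at_right_filter; exact: cdF.
- by apply/cvg_ex; exists (dF (r n)); apply: cvg_at_left_filter; exact: cdF.
- split=> [x _||]; first exact: (@ex_derive _ _ _ _ _ _ _ (derF _)).
  + by apply: cvg_at_right_filter; exact: cF.
  + by apply: cvg_at_left_filter; exact: cF.
- apply: continuous_in_subspaceT => y; rewrite inE/= in_itv/= => /andP[ly _].
  by apply: cG; rewrite in_itv/= (lt_le_trans (bF _ (al n))).
Qed.

(** * Positive extended reals *)

Lemma integral_gt0 d (T : measurableType d) (R : realType)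
    (mu : {measure set T -> \bar R}) (D : set T) (f : T -> \bar R) :
  measurable D -> (0 < mu D)%E -> measurable_fun D f ->
  (forall x, D x -> (0 < f x)%E) -> (0 < \int[mu]_(x in D) f x)%E.
Proof.
move=> mD muD mf f0; rewrite lt_neqAle integral_ge0 ?andbT//; last first.
  by move=> x /f0/ltW.
apply/eqP => int0.
have /(ae_eq_integral_abs mu mD mf) : (\int[mu]_(x in D) `|f x| = 0)%E.
  rewrite int0; apply: eq_integral => x; rewrite inE => /f0/ltW.
  exact: gee0_abs.
move=> [N [mN N0 DN]]; move: muD; rewrite ltNge => /negP; apply.
rewrite -N0; apply: le_measure; rewrite ?inE// => x Dx; apply: DN => /(_ Dx).
by apply/eqP; rewrite gt_eqF// f0.
Qed.

(** Infinite values are covered: if [x] or [y] is [+oo] then so is the product,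
    and [fine] sends [+oo] to [0] on both sides. *)
Lemma fineM_gt0 (R : realType) (x y : \bar R) :
  (0 < x)%E -> (0 < y)%E -> fine (x * y) = fine x * fine y.
Proof.
case: x y => [x| |] [y| |] // x0 y0.
- by rewrite gt0_muley//= mulr0.
- by rewrite gt0_mulye//= mul0r.
- by rewrite gt0_mulye//= mul0r.
Qed.

(** * Real powers *)

Lemma powR_succ (R : realType) (x r : R) : 0 < x -> x `^ (r + 1) = x `^ r * x.
Proof.
move=> x0; rewrite powRD; last by rewrite (gt_eqF x0) implybT.
by rewrite powRr1; last exact: ltW.
Qed.

Lemma continuous_powR (R : realType) (r x : R) :
  0 < x -> {for x, continuous (fun y => y `^ r)}.
Proof.
move=> x0; apply/differentiable_continuous/derivable1_diffP.
exact: (@ex_derive _ _ _ _ _ _ _ (is_derive1_powR r x0)).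
Qed.

(** * Iterated integrals over planar regions *)

(** A region of the plane is given by its sections [E x] for [x] in [D].  The
    integrand extended by [0] outside the region is measurable on the whole
    plane, where Tonelli's theorem applies; the sections then reappear as the
    domains of integration. *)
Section region.
Context {R : realType}.
Local Notation mu := (@lebesgue_measure R).
Local Notation RR := (measurableTypeR R * measurableTypeR R)%type.
Variables (D : set (measurableTypeR R)) (E : R -> set R) (f : RR -> R).
Let A : set RR := [set z | D z.1 /\ E z.1 z.2].
Hypothesis mA : measurable A.
Hypothesis mf : measurable_fun setT f.
Hypothesis f0 : forall x y, D x -> E x y -> 0 <= f (x, y).

Let g : RR -> \bar R := (EFin \o f) \_ A.

Let mg : measurable_fun setT g.
Proof.
apply/(measurable_restrictT _ mA); apply/measurable_EFinP.
exact: measurable_funTS.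
Qed.

Let g0 z : (0 <= g z)%E.
Proof.
rewrite /g patchE; case: ifPn => //.
by case: z => x y; rewrite inE /A/= => -[Dx Exy]; rewrite lee_fin f0.
Qed.

Let integral_g :
  (fun x => \int[mu]_(y in E x) (f (x, y))%:E)%E \_ D =
  (fun x => \int[mu]_y g (x, y))%E.
Proof.
apply/funext => x; rewrite patchE; case: ifPn => [|/negP]; rewrite inE => Dx.
  rewrite integral_mkcond; apply: eq_integral => y _; rewrite /g !patchE/=.
  by congr (if _ then _ else _); apply/idP/idP; rewrite !inE /A//= => -[].
rewrite integral0_eq// => y _; rewrite /g patchE ifF//.
by apply/negP; rewrite inE => -[].
Qed.

Lemma measurable_integral_region : measurable D ->
  measurable_fun D (fun x => \int[mu]_(y in E x) (f (x, y))%:E)%E.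
Proof.
move=> mD; apply/(measurable_restrictT _ mD); rewrite integral_g.
exact: (measurable_fun_fubini_tonelli_F g).
Qed.

(** [D] with [E], and [D'] with [E'], describe the same region by its vertical
    and by its horizontal sections. *)
Lemma tonelli_region (D' : set R) (E' : R -> set R) :
  (forall x y, D x /\ E x y <-> D' y /\ E' y x) ->
  (\int[mu]_(x in D) \int[mu]_(y in E x) (f (x, y))%:E =
   \int[mu]_(y in D') \int[mu]_(x in E' y) (f (x, y))%:E)%E.
Proof.
move=> DE; rewrite integral_mkcond integral_g (fubini_tonelli g)//.
rewrite [RHS]integral_mkcond; apply: eq_integral => y _; rewrite patchE.
case: ifPn => [|/negP]; rewrite inE => D'y.
  rewrite [RHS]integral_mkcond; apply: eq_integral => x _; rewrite /g !patchE/=.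
  congr (if _ then _ else _); apply/idP/idP; rewrite !inE /A/=.
    by move/DE => -[].
  by move=> E'yx; apply/DE.
rewrite integral0_eq// => x _; rewrite /g patchE ifF//.
by apply/negP; rewrite inE /A/= => /DE[].
Qed.

End region.

Lemma measurable_set_bool d (T : measurableType d) (b : T -> bool) :
  measurable_fun setT b -> measurable [set z | b z].
Proof.
by move=> /(_ measurableT [set true]); rewrite setTI preimage_true; exact.
Qed.

(** The part of the quadrant below the diagonal is reflected onto the part above
    it: exchanging the order of integration there and renaming the variables
    gives an integral over [0 < x < y] of [k (y, x)].  The diagonal itself is
    null. *)
Lemma integral_quadrant_fold (R : realType)
    (k : measurableTypeR R * measurableTypeR R -> R) :
  measurable_fun setT k -> (forall x y, 0 < x -> 0 < y -> 0 <= k (x, y)) ->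
  (\int[lebesgue_measure]_(x in `]0%R, +oo[)
     \int[lebesgue_measure]_(y in `]0%R, +oo[) (k (x, y))%:E =
   \int[lebesgue_measure]_(x in `]0%R, +oo[)
     \int[lebesgue_measure]_(y in `]x, +oo[) (k (x, y) + k (y, x))%:E)%E.
Proof.
move=> mk k0; set P := `]0, +oo[%classic : set R.
pose low (x : R) : set R := `]0, x]%classic.
pose upp (x : R) : set R := `]x, +oo[%classic.
have mk' : measurable_fun setT (fun z => k (z.2, z.1)).
  by apply: (measurableT_comp mk); exact: measurable_fun_pair.
have mkr (x : R) :
    measurable_fun [set: measurableTypeR R] (fun y => (k (x, y))%:E).
  by apply/measurable_EFinP; exact: (measurableT_comp mk).
have mkl (x : R) :
    measurable_fun [set: measurableTypeR R] (fun y => (k (y, x))%:E).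
  by apply/measurable_EFinP; exact: (measurableT_comp mk).
have mlow : measurable [set z : measurableTypeR R * measurableTypeR R |
    P z.1 /\ `]0, z.1]%classic z.2].
  rewrite (_ : [set _ | _] = [set z | [&& 0 < z.1, 0 < z.2 & z.2 <= z.1]]).
    apply: measurable_set_bool.
    apply: measurable_and; first exact: measurable_fun_ltr.
    apply: measurable_and;
      (exact: measurable_fun_ltr || exact: measurable_fun_ler).
  apply/seteqP; split=> z; rewrite /P/= !in_itv/= andbT.
    by move=> [-> /andP[-> ->]].
  by move=> /and3P[-> -> ->].
have mupp : measurable [set z : measurableTypeR R * measurableTypeR R |
    P z.1 /\ `]z.1, +oo[%classic z.2].
  rewrite (_ : [set _ | _] = [set z | (0 < z.1) && (z.1 < z.2)]).
    apply: measurable_set_bool.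
    by apply: measurable_and; exact: measurable_fun_ltr.
  apply/seteqP; split=> z; rewrite /P/= !in_itv/= !andbT.
    by move=> [-> ->].
  by move=> /andP[-> ->].
have mP : measurable (P : set (measurableTypeR R)) by exact: measurable_itv.
have k0low x y : P x -> `]0, x]%classic y -> 0 <= k (x, y).
  by rewrite /P/= !in_itv/= andbT => x0 /andP[y0 _]; exact: k0.
have k0upp x y : P x -> `]x, +oo[%classic y -> 0 <= k (x, y).
  rewrite /P/= !in_itv/= !andbT => x0 xy.
  by apply: k0 => //; exact: lt_trans xy.
have k0upp' x y : P x -> `]x, +oo[%classic y -> 0 <= k (y, x).
  rewrite /P/= !in_itv/= !andbT => x0 xy.
  by apply: k0 => //; exact: lt_trans xy.
transitivity (\int[lebesgue_measure]_(x in P)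
    (\int[lebesgue_measure]_(y in `]0%R, x]) (k (x, y))%:E +
     \int[lebesgue_measure]_(y in `]x, +oo[) (k (x, y))%:E))%E.
  apply: eq_integral => x; rewrite inE => Px.
  rewrite -ge0_integral_setU//=.
  - congr (integral _ _ _).
    move: Px; rewrite /P/= in_itv/= andbT => x0.
    apply/seteqP; split => y; rewrite /= !in_itv/= !andbT.
      by move=> y0; case: (leP y x) => xy; [left; rewrite y0|right].
    by move=> [/andP[]//|]; exact: lt_trans.
  - exact: (measurable_funTS (mkr x)).
  - by move=> y [yx|yx]; rewrite lee_fin; [exact: k0low|exact: k0upp].
  - rewrite disj_set2E; apply/eqP; rewrite -subset0 => y/=.
    by rewrite !in_itv/= andbT => -[/andP[_ yx]]; rewrite ltNge yx.
rewrite ge0_integralD//=; last 4 first.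
- by move=> x Px; apply: integral_ge0 => y xy; rewrite lee_fin k0low.
- exact: (@measurable_integral_region _ P low k mlow mk k0low mP).
- by move=> x Px; apply: integral_ge0 => y xy; rewrite lee_fin k0upp.
- exact: (@measurable_integral_region _ P upp k mupp mk k0upp mP).
rewrite (@tonelli_region _ P low k mlow mk k0low P
  (fun y : R => `[y, +oo[%classic)); last first.
  move=> x y; rewrite /P/low/= !in_itv/= !andbT.
  split=> [[x0 /andP[y0 yx]] //|[y0 yx]].
  by rewrite (lt_le_trans y0 yx) y0.
(* The reflected sections contain the diagonal, a single point of each line. *)
under [X in (X + _)%E]eq_integral => x _.
  rewrite -integral_itv_obnd_cbnd; last exact: (measurable_funTS (mkl x)).
  over.
rewrite -ge0_integralD//=.
- apply: eq_integral => x; rewrite inE => Px.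
  rewrite -ge0_integralD//=; first by apply: eq_integral => y _; rewrite addrC.
  + by move=> y xy; rewrite lee_fin k0upp'.
  + exact: (measurable_funTS (mkl x)).
  + by move=> y xy; rewrite lee_fin k0upp.
  + exact: (measurable_funTS (mkr x)).
- by move=> x Px; apply: integral_ge0 => y xy; rewrite lee_fin k0upp'.
- exact: (@measurable_integral_region _ P upp _ mupp mk' k0upp' mP).
- by move=> x Px; apply: integral_ge0 => y xy; rewrite lee_fin k0upp.
- exact: (@measurable_integral_region _ P upp k mupp mk k0upp mP).
Qed.

(** New coordinate [d = y - x] on the octant [0 < x < y], which becomes the
    quadrant; the outer variable is then [d], so that [x] can be changed
    next. *)
Lemma integral_shear (R : realType)
    (h : measurableTypeR R * measurableTypeR R -> R) :
  measurable_fun setT h ->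
  (forall x y, 0 < x -> x < y -> 0 <= h (x, y)) ->
  (forall x, 0 < x -> {in `]x, +oo[, continuous (fun y : R => h (x, y))}) ->
  (\int[lebesgue_measure]_(x in `]0%R, +oo[)
     \int[lebesgue_measure]_(y in `]x, +oo[) (h (x, y))%:E =
   \int[lebesgue_measure]_(d in `]0%R, +oo[)
     \int[lebesgue_measure]_(x in `]0%R, +oo[) (h (x, (x + d)%R))%:E)%E.
Proof.
move=> mh h0 ch; set P := `]0, +oo[%classic : set R.
transitivity (\int[lebesgue_measure]_(x in P)
    \int[lebesgue_measure]_(d in P) (h (x, (x + d)%R))%:E)%E.
  apply: eq_integral => x; rewrite inE /P/= in_itv/= andbT => x0.
  have dF (d : R) : is_derive d 1 (fun d => x + d) (cst 1 d).
    by apply: is_derive_eq; rewrite add0r mulr1.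
  rewrite (@ge0_integral_substitution_oy _ _ _ (fun y => h (x, y)) 0 x dF).
  - by apply: eq_integral => d _; rewrite /= mulr1.
  - by move=> d; exact: cst_continuous.
  - by move=> d e _ _ de; rewrite ltrD2l.
  - apply/seteqP; split => [_ [d + <-]|y]; rewrite /= !in_itv/= !andbT.
      by rewrite ltrDl.
    move=> xy; exists (y - x); last by rewrite addrC subrK.
    by rewrite in_itv/= subr_gt0 andbT.
  - exact: ch.
  - by move=> y; rewrite in_itv/= andbT => xy; exact: h0.
apply: (@tonelli_region _ P (fun _ => P) (fun z => h (z.1, z.1 + z.2))).
- rewrite (_ : [set _ | _] = P `*` P)//.
  by apply: measurableX; exact: measurable_itv.
- apply: (measurableT_comp mh); apply: measurable_fun_pair => //.
  exact: measurable_funD.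
- by move=> x d; rewrite /P/= !in_itv/= !andbT => x0 d0; rewrite h0// ltrDl.
- by move=> x d; split=> -[].
Qed.

(** * Integral representations of the Gamma function *)

Definition Gamma_integral (R : realType) (a : R) : \bar R :=
  (\int[lebesgue_measure]_(t in `]0%R, +oo[) (expR (- t) * t `^ (a - 1))%:E)%E.

Lemma continuous_Gamma_integrand (R : realType) (a t : R) : 0 < t ->
  {for t, continuous (fun t => expR (- t) * t `^ (a - 1))}.
Proof.
move=> t0; apply: continuousM; last exact: continuous_powR.
by apply: continuous_comp; [exact: opp_continuous|exact: continuous_expR].
Qed.

Lemma Gamma_integral_gt0 (R : realType) (a : R) : (0 < Gamma_integral R a)%E.
Proof.
apply: integral_gt0 => //.
- have := @lebesgue_measure_itv R `]0%R, +oo[; rewrite /= ltry => ->.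
  exact: ltry.
- apply: (@measurable_fun_continuous_oy _ (fun t => expR (- t) * t `^ (a - 1))).
  move=> t; rewrite in_itv/= andbT => t0.
  exact: continuous_Gamma_integrand.
- move=> t; rewrite /= in_itv/= andbT lte_fin => t0.
  by rewrite mulr_gt0 ?expR_gt0 ?powR_gt0.
Qed.

(** Substitution [t = k * x * (x + d)].  The values [k = 1, d = 0] give the
    Gaussian form of the integral; the values [k = 2, d = y - x] give the
    variable [2xy] of the duplication formula. *)
Lemma Gamma_integral_quadratic (R : realType) (k d a : R) : 0 < k -> 0 <= d ->
  Gamma_integral R a =
  (\int[lebesgue_measure]_(x in `]0%R, +oo[)
    (expR (- (k * (x * (x + d)))) * (k * (x * (x + d))) `^ (a - 1) *
     (k * (2 * x + d)))%:E)%E.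
Proof.
move=> k0 d0; pose F x : R := k * (x * (x + d)).
apply: (@ge0_integral_substitution_oy _ F (fun x => k * (2 * x + d))
  (fun t => expR (- t) * t `^ (a - 1))).
- move=> x; rewrite /F; apply: is_derive_eq.
  by rewrite /GRing.scale/=; ring.
- move=> x; apply: cvgM; first exact: cvg_cst.
  apply: cvgD; last exact: cvg_cst.
  by apply: cvgM; [exact: cvg_cst|exact: cvg_id].
- move=> x y; rewrite !in_itv/= !andbT => x0 y0 xy.
  by rewrite /F ltr_pM2l// ltr_pM ?ltrD2r// ltW// ltr_wpDr.
- apply/seteqP; split => [_ [x + <-]|v]; rewrite /= !in_itv/= !andbT.
    by move=> x0; rewrite /F !mulr_gt0// ltr_wpDr.
  move=> v0.
  (* The preimage of v is the positive root of x^2 + d x - v / k. *)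
  pose s := Num.sqrt (d ^+ 2 + 4 * (v / k)).
  have vk : 0 < v / k by rewrite divr_gt0.
  have s2 : s ^+ 2 = d ^+ 2 + 4 * (v / k).
    by rewrite sqr_sqrtr// addr_ge0 ?sqr_ge0// mulr_ge0// ltW.
  exists ((s - d) / 2).
    rewrite in_itv/= andbT divr_gt0// subr_gt0.
    by rewrite -(ltr_pXn2r (ltn0Sn 1)) ?nnegrE ?sqrtr_ge0// s2 ltrDl mulr_gt0.
  rewrite /F (_ : _ * (_ + d) = (s ^+ 2 - d ^+ 2) / 4); last by field.
  by rewrite s2; field; rewrite gt_eqF.
- move=> t; rewrite in_itv/= andbT => t0.
  exact: continuous_Gamma_integrand.
- by move=> t _; rewrite mulr_ge0 ?expR_ge0 ?powR_ge0.
Qed.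

Lemma Gamma_integral_gauss (R : realType) (a : R) :
  Gamma_integral R a =
  (2%:E * \int[lebesgue_measure]_(x in `]0%R, +oo[)
     (gauss_fun x * x `^ (2 * a - 1))%:E)%E.
Proof.
rewrite (@Gamma_integral_quadratic _ 1 0)// -ge0_integralZl//=.
- apply: eq_integral => x; rewrite inE/= in_itv/= andbT => x0.
  rewrite -EFinM; congr EFin.
  have -> : 2 * a - 1 = (a - 1) + (a - 1) + 1 by ring.
  rewrite powR_succ// (@powRD _ x); last by rewrite (gt_eqF x0) implybT.
  rewrite !mul1r !addr0 powRM ?(ltW x0)// /gauss_fun expr2; ring.
- apply/measurable_EFinP/measurable_funM.
    exact: (measurable_funTS measurable_gauss_fun).
  exact: (measurable_funTS (measurable_powR _)).
- by move=> x _; rewrite lee_fin mulr_ge0 ?gauss_fun_ge0 ?powR_ge0.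
Qed.

(** * The duplication formula *)

Lemma Gamma_integral_duplication (R : realType) (a : R) :
  (Gamma_integral R a * Gamma_integral R (a + 1 / 2) =
   (2 `^ (1 - 2 * a) * Num.sqrt pi)%:E * Gamma_integral R (2 * a))%E.
Proof.
pose P := `]0, +oo[%classic : set (measurableTypeR R).
have mP : measurable P by exact: measurable_itv.
pose f (x : R) := gauss_fun x * x `^ (2 * a - 1).
have f0 x : 0 <= f x by rewrite mulr_ge0 ?gauss_fun_ge0 ?powR_ge0.
have mf : measurable_fun [set: measurableTypeR R] f.
  apply: measurable_funM; first exact: measurable_gauss_fun.
  exact: measurable_powR.
have cf x : 0 < x -> {for x, continuous f}.
  move=> x0; apply: continuousM; first exact: continuous_gauss_fun.
  exact: continuous_powR.
have GE : Gamma_integral R a =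
    (2%:E * \int[lebesgue_measure]_(x in P) (f x)%:E)%E.
  exact: Gamma_integral_gauss.
have GE' : Gamma_integral R (a + 1 / 2) =
    (2%:E * \int[lebesgue_measure]_(y in P) (f y * y)%:E)%E.
  rewrite Gamma_integral_gauss; congr (_ * _)%E.
  apply: eq_integral => y; rewrite inE /P/= in_itv/= andbT => y0.
  rewrite (_ : 2 * (a + 1 / 2) - 1 = (2 * a - 1) + 1); last by field.
  by rewrite powR_succ// mulrA.
have prodE : (\int[lebesgue_measure]_(x in P) (f x)%:E *
     \int[lebesgue_measure]_(y in P) (f y * y)%:E =
   \int[lebesgue_measure]_(x in P) \int[lebesgue_measure]_(y in P)
     (f x * (f y * y))%:E)%E.
  rewrite -ge0_integralZr//=.
  - apply: eq_integral => x _; rewrite -ge0_integralZl//=.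
    + apply/measurable_EFinP; apply: measurable_funTS; exact: measurable_funM.
    + move=> y; rewrite /P/= in_itv/= andbT => y0.
      by rewrite lee_fin mulr_ge0// ltW.
    + by rewrite lee_fin.
  - by apply/measurable_EFinP; exact: measurable_funTS.
  - by move=> x _; rewrite lee_fin.
  - apply: integral_ge0 => y; rewrite /P/= in_itv/= andbT => y0.
    by rewrite lee_fin mulr_ge0// ltW.
have foldE : (\int[lebesgue_measure]_(x in P) \int[lebesgue_measure]_(y in P)
     (f x * (f y * y))%:E =
   \int[lebesgue_measure]_(d in P) \int[lebesgue_measure]_(x in P)
     (f x * f (x + d) * (2 * x + d))%:E)%E.
  rewrite (@integral_quadrant_fold _ (fun z => f z.1 * (f z.2 * z.2))).
  - transitivity (\int[lebesgue_measure]_(x in P)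
        \int[lebesgue_measure]_(y in `]x, +oo[) (f x * f y * (x + y))%:E)%E.
      apply: eq_integral => x _; apply: eq_integral => y _.
      by congr EFin => /=; ring.
    rewrite (@integral_shear _ (fun z => f z.1 * f z.2 * (z.1 + z.2))).
    + apply: eq_integral => d _; apply: eq_integral => x _ /=.
      by congr EFin; ring.
    + apply: measurable_funM; last exact: measurable_funD.
      by apply: measurable_funM; exact: (measurableT_comp mf).
    + move=> x y x0 xy /=; apply: mulr_ge0; first exact: mulr_ge0.
      by apply/ltW/addr_gt0 => //; exact: lt_trans xy.
    + move=> x x0 y; rewrite in_itv/= andbT => xy.
      apply: cvgM.
        by apply: cvgM; [exact: cvg_cst|apply: cf; exact: lt_trans xy].
      by apply: cvgD; [exact: cvg_cst|exact: cvg_id].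
  - apply: measurable_funM; first exact: (measurableT_comp mf).
    by apply: measurable_funM => //; exact: (measurableT_comp mf).
  - move=> x y x0 y0 /=; apply: mulr_ge0 => //.
    by apply: mulr_ge0 => //; exact: ltW.
have innerE d : P d ->
  (\int[lebesgue_measure]_(x in P) (f x * f (x + d) * (2 * x + d))%:E =
   (gauss_fun d * 2 `^ (- (2 * a)))%:E * Gamma_integral R (2 * a))%E.
  rewrite /P/= in_itv/= andbT => d0.
  rewrite (@Gamma_integral_quadratic _ 2 d _)//; last exact: ltW.
  rewrite -ge0_integralZl//=.
  - apply: eq_integral => x; rewrite inE /P/= in_itv/= andbT => x0.
    have xd0 : 0 < x + d by rewrite addr_gt0.
    rewrite -EFinM; congr EFin; rewrite /f /gauss_fun.
    rewrite (@powRM _ 2) ?mulr_ge0 ?(ltW x0) ?(ltW xd0)//.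
    rewrite powRM ?(ltW x0) ?(ltW xd0)//.
    (* 2^(- 2a) balances the powers of 2 in (2xy)^(2a - 1) and the Jacobian. *)
    have two : 2 `^ (- (2 * a)) * 2 `^ (2 * a - 1) * 2 = 1 :> R.
      rewrite -powRD ?pnatr_eq0 ?implybT// -powR_succ//.
      by rewrite (_ : _ + _ = 0) ?powRr0//; ring.
    (* This is x^2 + y^2 = d^2 + 2xy for y = x + d. *)
    have ex : expR (- x ^+ 2) * expR (- (x + d) ^+ 2) =
        expR (- d ^+ 2) * expR (- (2 * (x * (x + d)))).
      by rewrite -!expRD; congr expR; ring.
    transitivity ((expR (- x ^+ 2) * expR (- (x + d) ^+ 2)) *
      (x `^ (2 * a - 1) * (x + d) `^ (2 * a - 1)) * (2 * x + d)); first by ring.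
    rewrite ex -[LHS]mulr1 -[X in _ * X = _]two; ring.
  - apply/measurable_EFinP/measurable_funTS.
    have mq : measurable_fun [set: measurableTypeR R]
        (fun x : R => 2 * (x * (x + d))).
      apply: measurable_funM => //; apply: measurable_funM => //.
      exact: measurable_funD.
    apply: measurable_funM; first apply: measurable_funM.
    + by apply: measurableT_comp => //; exact: measurableT_comp.
    + exact: (measurableT_comp (measurable_powR _)).
    + by apply: measurable_funM => //; exact: measurable_funD.
  - move=> x; rewrite /P/= in_itv/= andbT => x0.
    by rewrite lee_fin !mulr_ge0 ?expR_ge0 ?powR_ge0// addr_ge0 ?mulr_ge0 ?ltW.
  - by rewrite lee_fin mulr_ge0 ?gauss_fun_ge0 ?powR_ge0.
rewrite GE GE' muleACA prodE foldE.
under eq_integral => d /set_mem Pd do rewrite (innerE d Pd).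
have mg : measurable_fun P (fun d : R => (gauss_fun d)%:E).
  apply/measurable_EFinP; apply: measurable_funTS.
  exact: measurable_gauss_fun.
have gaussE : (\int[lebesgue_measure]_(d in P) (gauss_fun d)%:E =
    (Num.sqrt pi / 2)%:E)%E.
  by rewrite -integral0y_gauss; apply: integral_itv_obnd_cbnd.
have G0 : (0 <= Gamma_integral R (2 * a))%E by exact/ltW/Gamma_integral_gt0.
under eq_integral do rewrite EFinM -muleA.
rewrite ge0_integralZr//=; last 2 first.
- by move=> d _; rewrite lee_fin gauss_fun_ge0.
- by rewrite mule_ge0// lee_fin powR_ge0.
rewrite gaussE !muleA -!EFinM; congr (_%:E * _)%E.
by rewrite powRD ?pnatr_eq0 ?implybT// powRr1//; field.
Qed.

Theorem corollary3 (R : realType) (alpha : R) (halpha : 0 < alpha) :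
  Gamma alpha * Gamma (alpha + 1 / 2) =
  2 `^ (1 - 2 * alpha) * Num.sqrt pi * Gamma (2 * alpha).
Proof.
have GE a : Gamma a = fine (Gamma_integral R a) by [].
rewrite !GE -fineM_gt0 ?Gamma_integral_gt0// Gamma_integral_duplication.
rewrite fineM_gt0 ?Gamma_integral_gt0//.
by rewrite lte_fin mulr_gt0 ?powR_gt0 ?sqrtr_gt0 ?pi_gt0.
Qed.
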